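(* Let $A$ be a Noetherian ring and let $B$ be a GD-overring of $A$ which is integral over $A$. Then every regular prime ideal of $A$ which is not a minimal regular prime ideal is unibranched in $B$.
   Context: All rings are commutative with unity. For a ring $A$, $\mathrm{Reg}(A)$ is the set of regular elements (non-zero-divisors) of $A$, and the total quotient ring $K$ of $A$ is the fraction ring of $A$ with denominators in $\mathrm{Reg}(A)$. An ideal of $A$ is regular if it contains a regular element. A prime ideal is minimal regular if it is minimal in the set of regular prime ideals. An overring of $A$ is a ring $B$ with $A\subseteq B\subseteq K$. A ring extension $A\subseteq B$ satisfies going down if, whenever $P_1\subseteq P_2$ are prime ideals of $A$ and $Q_2$ is a prime ideal of $B$ with $Q_2\cap A=P_2$, there is a prime ideal $Q_1\subseteq Q_2$ of $B$ with $Q_1\cap A=P_1$. A GD-overring of $A$ is an overring $B$ of $A$ such that $A\subseteq B$ satisfies going down. For a ring extension $A\subseteq B$, a prime ideal $P$ of $A$ is unibranched in $B$ if there exists a unique prime ideal of $B$ lying over $P$. *)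

(* Defs.v *)
From mathcomp Require Import all_boot all_order all_algebra.
From mathcomp Require Import all_classical.

Set Implicit Arguments.
Unset Strict Implicit.
Unset Printing Implicit Defensive.

Import GRing.Theory.

Local Open Scope ring_scope.
Local Open Scope classical_set_scope.

(* [idealr_closed] of ring_quotient only describes proper ideals, on boolean
   predicates; here the unit ideal is an ideal and ideals are classical sets. *)
Definition is_ideal (A : comNzRingType) (I : set A) : Prop :=
  [/\ I 0,
      forall x y, I x -> I y -> I (x + y)
    & forall a x, I x -> I (a * x)].

Definition is_prime (A : comNzRingType) (P : set A) : Prop :=
  [/\ is_ideal P, ~ P 1 & forall x y, P (x * y) -> P x \/ P y].

Definition noetherian (A : comNzRingType) : Prop :=
  forall I : set A, is_ideal I ->
    exists s : seq A, I = smallest (@is_ideal A) [set` s].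

(* In a commutative ring [GRing.lreg s], i.e. injectivity of multiplication
   by s, says that s is a non-zero-divisor. *)
Definition regular_set (A : comNzRingType) (I : set A) : Prop :=
  exists2 s, I s & GRing.lreg s.

Definition is_regular_prime (A : comNzRingType) (P : set A) : Prop :=
  is_prime P /\ regular_set P.

Definition is_minimal_regular_prime (A : comNzRingType) (P : set A) : Prop :=
  is_regular_prime P /\
  forall P', is_regular_prime P' -> P' `<=` P -> P' = P.

(* [phi] exhibits K as the localization of A at its regular elements, which
   determines (K, phi) up to a unique isomorphism. *)
Definition is_total_quotient_ring (A : comNzRingType) (K : comUnitRingType)
    (phi : {rmorphism A -> K}) : Prop :=
  [/\ injective phi,
      forall s : A, GRing.lreg s -> phi s \is a GRing.unit
    & forall x : K, exists a s : A, GRing.lreg s /\ x = phi a / phi s].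

(* The inclusions in A <= B <= K are given as ring embeddings [i] and [j];
   injectivity of [i] follows from that of [phi]. *)
Definition is_overring (A B : comNzRingType) (K : comUnitRingType)
    (phi : {rmorphism A -> K}) (i : {rmorphism A -> B})
    (j : {rmorphism B -> K}) : Prop :=
  [/\ is_total_quotient_ring phi, injective j & j \o i =1 phi].

(* For an extension given by an embedding i, the contraction of Q to A is
   [i @^-1` Q]. *)
Definition going_down (A B : comNzRingType) (i : {rmorphism A -> B}) : Prop :=
  forall (P1 P2 : set A) (Q2 : set B),
    is_prime P1 -> is_prime P2 -> is_prime Q2 ->
    P1 `<=` P2 -> i @^-1` Q2 = P2 ->
    exists Q1 : set B, [/\ is_prime Q1, Q1 `<=` Q2 & i @^-1` Q1 = P1].

Definition is_GD_overring (A B : comNzRingType) (K : comUnitRingType)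
    (phi : {rmorphism A -> K}) (i : {rmorphism A -> B})
    (j : {rmorphism B -> K}) : Prop :=
  is_overring phi i j /\ going_down i.

Definition integral_extension (A B : comNzRingType)
    (i : {rmorphism A -> B}) : Prop :=
  forall b : B, integralOver i b.

Definition unibranched (A B : comNzRingType) (i : {rmorphism A -> B})
    (P : set A) : Prop :=
  exists! Q : set B, is_prime Q /\ i @^-1` Q = P.

(* Main.v *)
(* Suppose Q and Q' lie over P, b is in Q but not in Q', and s b = a with a, s
   in A and s regular.  For x in P let q be a prime of A[b] inside Q containing
   b + x.  If s is not in q, then going down applied to q \cap A and Q' gives a
   prime q' of B inside Q' over q \cap A; it contains s (b + x) = a + s x but
   not s, so b is in Q', a contradiction.  Hence s is in q.  Choose x so that
   b + x avoids the finitely many primes minimal over s strictly below Q, and q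
   minimal over b + x.  Krull's principal ideal theorem leaves only q = Q, which
   is impossible because going down yields a smaller regular prime below Q.
   Instead of A[b], the proof uses {poly A} and ideals containing the kernel I of
   the evaluation at b. *)
Require Import Defs.
From mathcomp Require Import all_boot all_order all_algebra.
From mathcomp Require Import all_classical.
From mathcomp Require Import zify ring.

Set Implicit Arguments.
Unset Strict Implicit.
Unset Printing Implicit Defensive.

Import GRing.Theory.

Local Open Scope ring_scope.
Local Open Scope classical_set_scope.

(** * Ideals and prime ideals *)

Section IdealTheory.
Variable R : comNzRingType.
Implicit Types (H I P Q : set R) (a u v x y z : R).

Lemma ideal0 I : is_ideal I -> I 0.
Proof. by case. Qed.

Lemma idealD I x y : is_ideal I -> I x -> I y -> I (x + y).
Proof. by case=> _ D _; exact: D. Qed.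

Lemma idealMl I a x : is_ideal I -> I x -> I (a * x).
Proof. by case=> _ _; apply. Qed.

Lemma idealMr I a x : is_ideal I -> I x -> I (x * a).
Proof. by rewrite mulrC; exact: idealMl. Qed.

Lemma idealN I x : is_ideal I -> I x -> I (- x).
Proof. by rewrite -mulN1r; exact: idealMl. Qed.

Lemma idealB I x y : is_ideal I -> I x -> I y -> I (x - y).
Proof. by move=> hI Ix Iy; exact: (idealD hI Ix (idealN hI Iy)). Qed.

Lemma prime_ideal P : is_prime P -> is_ideal P.
Proof. by case. Qed.

Lemma prime1 P : is_prime P -> ~ P 1.
Proof. by case. Qed.

Lemma primeM P x y : is_prime P -> ~ P x -> ~ P y -> ~ P (x * y).
Proof. by case=> _ _ h nx ny /h[]. Qed.

Lemma primeX P x n : is_prime P -> ~ P x -> ~ P (x ^+ n).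
Proof.
move=> hP nx; elim: n => [|n IH]; first exact: prime1.
by rewrite exprS; exact: primeM.
Qed.

Lemma idealX {I x} n : is_ideal I -> I x -> I (x ^+ n.+1).
Proof. by move=> hI Ix; rewrite exprS; exact: idealMr. Qed.

(** The ideal [H] + ([u]), described through congruence modulo [H]. *)
Definition ideal_adjoin H u : set R := [set z | exists r, H (z - r * u)].

Lemma ideal_adjoin_ideal H u : is_ideal H -> is_ideal (ideal_adjoin H u).
Proof.
move=> hH; split.
- by exists 0 => //; rewrite mul0r subr0; exact: ideal0.
- move=> x y [r Hr] [r' Hr']; exists (r + r') => //.
  have -> : x + y - (r + r') * u = (x - r * u) + (y - r' * u) by ring.
  exact: idealD.
- move=> a x [r Hr]; exists (a * r) => //.
  have -> : a * x - a * r * u = a * (x - r * u) by ring.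
  exact: idealMl.
Qed.

Lemma sub_ideal_adjoin H u : is_ideal H -> H `<=` ideal_adjoin H u.
Proof. by move=> hH x Hx; exists 0 => //; rewrite mul0r subr0. Qed.

Lemma mem_ideal_adjoin H u : is_ideal H -> ideal_adjoin H u u.
Proof. by move=> hH; exists 1 => //; rewrite mul1r subrr; exact: ideal0. Qed.

Lemma ideal_adjoin_sub H u I :
  is_ideal I -> H `<=` I -> I u -> ideal_adjoin H u `<=` I.
Proof.
move=> hI HI Iu z [r /HI Hz]; rewrite -(subrK (r * u) z).
by apply: idealD => //; exact: idealMl.
Qed.

Definition ideal_colon H u : set R := [set z | H (z * u)].

Lemma ideal_colon_ideal H u : is_ideal H -> is_ideal (ideal_colon H u).
Proof.
move=> hH; split; rewrite /ideal_colon /=.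
- by rewrite mul0r; exact: ideal0.
- by move=> x y Hx Hy; rewrite mulrDl; exact: idealD.
- by move=> a x Hx; rewrite -mulrA; exact: idealMl.
Qed.

Lemma nonprime_ideal H : is_ideal H -> ~ H 1 -> ~ is_prime H ->
  exists u v, [/\ ~ H u, ~ H v & H (u * v)].
Proof.
move=> hH n1 nP; apply: contrapT => nex; apply: nP; split=> // x y Hxy.
apply: contrapT => /not_orP[nx ny]; apply: nex.
by exists x, y.
Qed.

(** * Ascending chains and minimal primes *)

Definition acc := forall I : nat -> set R,
  (forall n, is_ideal (I n)) -> (forall n, I n `<=` I n.+1) ->
  exists n, forall m, (n <= m)%N -> I m `<=` I n.

Lemma chain_le (I : nat -> set R) : (forall n, I n `<=` I n.+1) ->
  forall m n, (m <= n)%N -> I m `<=` I n.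
Proof.
move=> hI m n /subnK <-; elim: (n - m)%N => [|k IH] //.
by apply: subset_trans IH _; rewrite addSn; exact: hI.
Qed.

Lemma chain_cup_ideal (I : nat -> set R) : (forall n, is_ideal (I n)) ->
  (forall n, I n `<=` I n.+1) -> is_ideal [set x | exists n, I n x].
Proof.
move=> hI inc; split.
- by exists 0%N; exact: ideal0.
- move=> x y [m Ix] [n Iy]; exists (maxn m n); apply: idealD => //.
    exact: (chain_le inc (leq_maxl _ _) Ix).
  exact: (chain_le inc (leq_maxr _ _) Iy).
- by move=> a x [n Ix]; exists n; exact: idealMl.
Qed.

(** The finitely many generators of the union of the chain all lie in one of its terms. *)
Lemma noetherian_acc : noetherian R -> acc.
Proof.
move=> noeR I hI inc.
have [s Us] := noeR _ (chain_cup_ideal hI inc).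
have sU x : x \in s -> exists n, I n x.
  move=> xs; suff: [set x | exists n, I n x] x by [].
  by rewrite Us => J [_]; apply.
have [n hn] : exists n, forall x, x \in s -> I n x.
  elim: s sU {Us} => [|x s IH] sU; first by exists 0%N.
  have [|n hn] := IH; first by move=> y ys; apply: sU; rewrite inE ys orbT.
  have [m hm] := sU x (mem_head _ _).
  exists (maxn m n) => y; rewrite inE => /orP[/eqP->|/hn].
    exact: (chain_le inc (leq_maxl _ _) hm).
  exact: (chain_le inc (leq_maxr _ _)).
exists n => m _ x Ix.
have : [set x | exists n, I n x] x by exists m.
by rewrite Us => /(_ (I n)); apply; split.
Qed.

(** Every counterexample has a strictly larger one. Choosing it by a function [F] and iterating [F]
    gives a chain that never stabilizes. *)
Lemma noetherian_ind (Phi : set R -> Prop) : acc ->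
  (forall H, is_ideal H ->
    (forall H', is_ideal H' -> H `<=` H' -> ~ H' `<=` H -> Phi H') -> Phi H) ->
  forall H, is_ideal H -> Phi H.
Proof.
move=> accR step H0 hH0; apply: contrapT => nPhi.
have /choice[F hF] : forall H, exists H', is_ideal H /\ ~ Phi H ->
    [/\ is_ideal H', ~ Phi H', H `<=` H' & ~ H' `<=` H].
  move=> H; have [[hH nH]|] := EM (is_ideal H /\ ~ Phi H); last by exists H.
  apply: contrapT => nex; apply: nH; apply: step => // H' hH' HH' H'H.
  by apply: contrapT => nH'; apply: nex; exists H'.
pose G n := iter n F H0.
have hG n : is_ideal (G n) /\ ~ Phi (G n).
  by elim: n => [|n /hF[]] //=; split.
have [n hn] := accR G (fun n => (hG n).1) (fun n => let: And4 _ _ h _ := hF _ (hG n) in h).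
by have [_ _ _] := hF _ (hG n); apply; exact: hn (leqnSn n).
Qed.

(** Noetherian induction: if [u * v] is in [H] but [u] and [v] are not, each prime over [H] contains
    [H] + ([u]) or [H] + ([v]), and the lists for these two ideals are concatenated. Nonminimal
    primes may occur in the result. *)
Lemma finite_primes_below H : acc -> is_ideal H ->
  exists s : seq (set R),
    (forall P, P \in s -> is_prime P /\ H `<=` P) /\
    (forall Q, is_prime Q -> H `<=` Q -> exists2 P, P \in s & P `<=` Q).
Proof.
move=> accR; move: H; apply: noetherian_ind => // H hH IH.
have [H1|n1] := EM (H 1).
  by exists [::]; split=> // Q hQ HQ; case: (prime1 hQ); exact: HQ.
have [pH|npH] := EM (is_prime H).
  exists [:: H]; split=> [P|Q hQ HQ]; first by rewrite inE => /eqP->; split.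
  by exists H => //; rewrite inE.
have [u [v [nu nv Huv]]] := nonprime_ideal hH n1 npH.
have adj w : ~ H w -> exists s : seq (set R),
    (forall P, P \in s -> is_prime P /\ ideal_adjoin H w `<=` P) /\
    (forall Q, is_prime Q -> ideal_adjoin H w `<=` Q ->
       exists2 P, P \in s & P `<=` Q).
  move=> nw; apply: IH; first exact: ideal_adjoin_ideal.
    exact: sub_ideal_adjoin.
  by move=> /(_ w (mem_ideal_adjoin _ hH)).
have [s [s1 s2]] := adj u nu; have [t [t1 t2]] := adj v nv.
exists (s ++ t); split=> [P|Q hQ HQ].
  have sH w := @sub_ideal_adjoin H w hH.
  by rewrite mem_cat => /orP[/s1|/t1] [hP hs]; split=> //;
    exact: subset_trans (sH _) hs.
have [Qu|Qv] : Q u \/ Q v by case: hQ => _ _; apply; exact: HQ.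
  have [|P Ps PQ] := s2 Q hQ; first exact: ideal_adjoin_sub (prime_ideal hQ) _ _.
  by exists P => //; rewrite mem_cat Ps.
have [|P Pt PQ] := t2 Q hQ; first exact: ideal_adjoin_sub (prime_ideal hQ) _ _.
by exists P => //; rewrite mem_cat Pt orbT.
Qed.

Lemma seq_minimal_subset (s : seq (set R)) Q : Q \in s ->
  exists P, [/\ P \in s, P `<=` Q &
    forall P', P' \in s -> P' `<=` P -> P `<=` P'].
Proof.
elim: {s}(size s) {-2}s (leqnn (size s)) Q => [|n IH] s.
  by rewrite leqn0 size_eq0 => /eqP->.
move=> ss Q Qs.
have [mQ|/existsNP[Q' /not_implyP[Q's /not_implyP[Q'Q nQQ']]]] :=
  EM (forall P', P' \in s -> P' `<=` Q -> Q `<=` P').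
  by exists Q; split.
(* [Q] itself is dropped, so the list gets shorter. A member of [s] inside the [P] found below is
   kept: otherwise it would contain [Q], and [Q] would lie in [Q']. *)
pose s' := [seq P <- s | `[< ~ Q `<=` P >]].
have Q's' : Q' \in s' by rewrite mem_filter Q's andbT; apply/asboolP.
have ss' : (size s' <= n)%N.
  rewrite -ltnS; apply: leq_trans ss; rewrite size_filter ltn_neqAle count_size andbT.
  by rewrite -all_count; apply/negP => /allP/(_ Q Qs)/asboolP[].
have [P [Ps' PQ' mP]] := IH s' ss' Q' Q's'.
move: (Ps'); rewrite mem_filter => /andP[_ Ps].
exists P; split=> // [|P' P's P'P]; first exact: subset_trans PQ' Q'Q.
apply: mP => //; rewrite mem_filter P's andbT; apply/asboolP => QP'.
by apply: nQQ'; apply: subset_trans QP' (subset_trans P'P PQ').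
Qed.

Lemma minimal_prime_exists H Q : acc -> is_ideal H -> is_prime Q -> H `<=` Q ->
  exists P, [/\ is_prime P, H `<=` P, P `<=` Q &
    forall P', is_prime P' -> H `<=` P' -> P' `<=` P -> P `<=` P'].
Proof.
move=> accR hH hQ HQ; have [s [s1 s2]] := finite_primes_below accR hH.
have [P0 P0s P0Q] := s2 Q hQ HQ.
have [P [Ps PP0 mP]] := seq_minimal_subset P0s.
have [hP HP] := s1 P Ps.
exists P; split=> //; first exact: subset_trans PP0 P0Q.
move=> P' hP' HP' P'P; have [P1 P1s P1P'] := s2 P' hP' HP'.
apply: (subset_trans _ P1P'); apply: mP => //.
exact: subset_trans P1P' P'P.
Qed.

(** * Krull's principal ideal theorem *)

(* For Q minimal over D, the localization of R/D at Q is Artinian. *)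
Lemma local_dcc Q D : acc -> is_prime Q ->
  (forall P, is_prime P -> D `<=` P -> P `<=` Q -> Q `<=` P) ->
  forall H, is_ideal H -> D `<=` H ->
  forall J : nat -> set R, (forall n, is_ideal (J n)) ->
    (forall n, H `<=` J n) -> (forall m n, (m <= n)%N -> J n `<=` J m) ->
  exists n, forall m, (n <= m)%N ->
    forall z, J n z -> exists2 t, ~ Q t & J m (t * z).
Proof.
move=> accR hQ minQ; apply: noetherian_ind => // H hH IH DH J hJ HJ dec.
(* An element of [H] outside [Q] multiplies everything into [H], hence into each [J m]. *)
have [HQ|/existsNP[t /not_implyP[Ht nQt]]] := EM (H `<=` Q); last first.
  exists 0%N => m _ z _; exists t => //.
  by apply: idealMr; [exact: hJ | exact: HJ].
have [pH|npH] := EM (is_prime H).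
  (* Here [H] = [Q]. Either some [J n] equals [H], or every [J m] has an element outside [Q], which
     serves as multiplier. *)
  have QH := minQ H pH DH HQ.
  have [[n nQ]|nex] := EM (exists n, J n `<=` Q).
    exists n => m _ z /nQ/QH Hz; exists 1; first exact: prime1.
    by rewrite mul1r; exact: HJ.
  exists 0%N => m _ z _; apply: contrapT => nt; apply: nex; exists m => t Jt.
  apply: contrapT => nQt; apply: nt; exists t => //; exact: idealMr (hJ m) Jt.
have [u [v [nu nv Huv]]] := nonprime_ideal hH (fun h1 => prime1 hQ (HQ _ h1)) npH.
(* The chain is controlled by the sums [J n] + ([u]) and the colons of [J n] by [u]. Induction
   applies to both: [H] + ([u]) gains [u], and the colon of [H] gains [v]. *)
have [n1 hn1] : exists n, forall m, (n <= m)%N ->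
    forall z, ideal_adjoin (J n) u z ->
    exists2 t, ~ Q t & ideal_adjoin (J m) u (t * z).
  apply: (IH (ideal_adjoin H u)).
  - exact: ideal_adjoin_ideal.
  - exact: sub_ideal_adjoin.
  - by move=> /(_ u (mem_ideal_adjoin _ hH)).
  - exact: subset_trans DH (sub_ideal_adjoin _ hH).
  - by move=> n; exact: ideal_adjoin_ideal.
  - by move=> n z [r Hr]; exists r => //; exact: HJ.
  - by move=> m n mn z [r Hr]; exists r => //; exact: dec mn _ Hr.
have [n2 hn2] : exists n, forall m, (n <= m)%N ->
    forall z, ideal_colon (J n) u z ->
    exists2 t, ~ Q t & ideal_colon (J m) u (t * z).
  apply: (IH (ideal_colon H u)).
  - exact: ideal_colon_ideal.
  - by move=> z Hz; exact: idealMr.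
  - by move=> /(_ v); rewrite /ideal_colon /= mulrC => /(_ Huv).
  - by move=> z /DH Hz; exact: idealMr.
  - by move=> n; exact: ideal_colon_ideal.
  - by move=> n z; exact: HJ.
  - by move=> m n mn z; exact: dec.
exists (maxn n1 n2) => m; rewrite geq_max => /andP[le1 le2] z Jz.
have [|t nt [r Jr]] := hn1 m le1 z.
  by apply: sub_ideal_adjoin => //; exact: dec (leq_maxl _ _) _ Jz.
have [|t' nt' Jr'] := hn2 m le2 r.
  rewrite /ideal_colon /=; have -> : r * u = t * z - (t * z - r * u) by ring.
  apply: idealB => //; last exact: dec le2 _ Jr.
  by apply: idealMl => //; exact: dec (leq_maxr _ _) _ Jz.
exists (t' * t); first exact: primeM.
have -> : t' * t * z = t' * (t * z - r * u) + t' * r * u by ring.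
by apply: idealD => //; exact: idealMl.
Qed.

(* Krull's principal ideal theorem in R/I, for chains that end in a regular
   prime: instead of the symbolic powers of the smaller prime P, use the
   contractions of the powers of s from the localization at P. *)
Lemma krull_principal_ideal I P Q b s : acc -> is_ideal I ->
  is_prime P -> is_prime Q -> I `<=` P -> P `<=` Q -> Q b ->
  (forall P', is_prime P' -> I `<=` P' -> P' b -> P' `<=` Q -> Q `<=` P') ->
  P s -> (forall z, I (s * z) -> I z) -> P b.
Proof.
move=> accR hI hP hQ IP PQ Qb minQ Ps regs; apply: contrapT => nPb.
have nPt t : ~ Q t -> ~ P t by move=> nQ /PQ.
pose S n : set R := [set z | exists t v, ~ P t /\ I (t * z - s ^+ n * v)].
have hS n : is_ideal (S n).
  split.
  - exists 1, 0; split; first exact: prime1.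
    by rewrite !mulr0 subr0; exact: ideal0.
  - move=> x y [t [v [nt Hx]]] [t' [v' [nt' Hy]]].
    exists (t * t'), (t' * v + t * v'); split; first exact: primeM.
    have -> : t * t' * (x + y) - s ^+ n * (t' * v + t * v') =
      t' * (t * x - s ^+ n * v) + t * (t' * y - s ^+ n * v') by ring.
    by apply: idealD => //; exact: idealMl.
  - move=> a x [t [v [nt Hx]]]; exists t, (a * v); split=> //.
    have -> : t * (a * x) - s ^+ n * (a * v) = a * (t * x - s ^+ n * v) by ring.
    exact: idealMl.
have IS n : I `<=` S n.
  move=> z Iz; exists 1, 0; split; first exact: prime1.
  by rewrite mulr0 subr0 mul1r.
have decS m n : (m <= n)%N -> S n `<=` S m.
  move=> /subnK <- z [t [v [nt Hz]]]; exists t, (s ^+ (n - m) * v); split=> //.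
  by rewrite mulrA -exprD addnC.
have satS n t z : ~ P t -> S n (t * z) -> S n z.
  move=> nt [t' [v [nt' Hz]]]; exists (t' * t), v; split; first exact: primeM.
  by rewrite -mulrA.
pose D := ideal_adjoin I b.
have hD : is_ideal D by exact: ideal_adjoin_ideal.
have minQ' P' : is_prime P' -> D `<=` P' -> P' `<=` Q -> Q `<=` P'.
  move=> hP' DP'; apply: minQ => //.
    exact: subset_trans (sub_ideal_adjoin _ hI) DP'.
  by apply: DP'; exact: mem_ideal_adjoin.
have [n /(_ n.+1 (leqnSn n)) hn] : exists n, forall m, (n <= m)%N ->
    forall z, ideal_adjoin (S n) b z ->
    exists2 t, ~ Q t & ideal_adjoin (S m) b (t * z).
  apply: (local_dcc accR hQ minQ' hD) => // [n|n z [r Hr]|m n mn z [r Hr]].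
  - exact: ideal_adjoin_ideal.
  - by exists r => //; exact: IS.
  - by exists r => //; exact: decS mn _ Hr.
(* After localization at [Q], [S n] becomes [S n.+1] + [b] [S n]. The factor [r] is in [S n] because
   [b], being outside [P], can be cancelled there. *)
have step v : S n v -> exists t r, [/\ ~ Q t, S n r & S n.+1 (t * v - b * r)].
  move=> Sv; have [t nt [r Hr]] := hn v (sub_ideal_adjoin _ (hS n) Sv).
  exists t, r; split=> //; last by rewrite (mulrC b).
  apply: (satS n b) => //; have -> : b * r = t * v - (t * v - r * b) by ring.
  apply: idealB => //; first exact: idealMl.
  exact: decS (leqnSn n) _ Hr.
(* [V v] is the contraction of the ideal generated by [S n.+1] and [v] in the localization at
   [Q]. *)
pose V v : set R := [set z | exists t c, ~ Q t /\ S n.+1 (t * z - c * v)].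
have hV v : is_ideal (V v).
  split.
  - exists 1, 0; split; first exact: prime1.
    by rewrite mulr0 mul0r subr0; exact: ideal0.
  - move=> x y [t [c [nt Hx]]] [t' [c' [nt' Hy]]].
    exists (t * t'), (t' * c + t * c'); split; first exact: primeM.
    have -> : t * t' * (x + y) - (t' * c + t * c') * v =
      t' * (t * x - c * v) + t * (t' * y - c' * v) by ring.
    by apply: idealD => //; exact: idealMl.
  - move=> a x [t [c [nt Hx]]]; exists t, (a * c); split=> //.
    have -> : t * (a * x) - a * c * v = a * (t * x - c * v) by ring.
    exact: idealMl.
(* Nakayama's lemma for one element at a time. Passing from [v] to the [r] of [step] can only
   enlarge [V]. Once [V] stops growing, [t * t' - c * b], which is outside [Q], multiplies [r] into
   [S n.+1]. *)
have nakayama : forall H, is_ideal H -> forall v, S n v -> H = V v -> S n.+1 v.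
  apply: noetherian_ind => // H hH IH v Sv HE; subst H.
  have [t [r [nt Sr Htr]]] := step v Sv.
  suff Sr' : S n.+1 r.
    apply: (satS _ t); first exact: nPt.
    by rewrite -(subrK (b * r) (t * v)); apply: idealD => //; exact: idealMl.
  have VV : V v `<=` V r.
    move=> z [t' [c [nt' Hz]]]; exists (t * t'), (c * b); split; first exact: primeM.
    have -> : t * t' * z - c * b * r =
      t * (t' * z - c * v) + c * (t * v - b * r) by ring.
    by apply: idealD => //; exact: idealMl.
  have [VrV|nVrV] := EM (V r `<=` V v); last exact: (IH (V r)).
  have [|t' [c [nt' Hr]]] := VrV r.
    exists 1, 1; split; first exact: prime1.
    by rewrite mul1r subrr; exact: ideal0.
  apply: (satS _ (t * t' - c * b)).
    apply: nPt => Qt; apply: (primeM hQ nt nt').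
    rewrite -(subrK (c * b) (t * t')); apply: idealD (prime_ideal hQ) Qt _.
    exact: idealMl (prime_ideal hQ) Qb.
  have -> : (t * t' - c * b) * r =
    t * (t' * r - c * v) + c * (t * v - b * r) by ring.
  by apply: idealD => //; exact: idealMl.
(* Since [s ^+ n] is in [S n], it is in [S n.+1]. Cancelling [s ^+ n] modulo [I] then forces some
   [t] outside [P] into [P]. *)
have [|t [v [nt]]] := nakayama _ (hV (s ^+ n)) (s ^+ n) _ erefl.
  exists 1, 1; split; first exact: prime1.
  by rewrite mulr1 mul1r subrr; exact: ideal0.
have -> : t * s ^+ n - s ^+ n.+1 * v = s ^+ n * (t - s * v) by rewrite exprS; ring.
have regsn k z : I (s ^+ k * z) -> I z.
  by elim: k => [|k IH]; rewrite ?expr0 ?mul1r // exprS -mulrA => /regs.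
move=> /regsn/IP Pt; apply: nt; rewrite -(subrK (s * v) t).
by apply: idealD (prime_ideal hP) Pt _; exact: idealMr (prime_ideal hP) Ps.
Qed.

(** * Prime avoidance *)

(* Two of the elements b + x^k, b + x^l in the same prime would put the factor
   1 - x^(l-k) of their difference in that prime, hence in Q. *)
Lemma prime_avoidance_coset (s : seq (set R)) Q b x : is_prime Q -> Q x ->
  (forall P, P \in s -> [/\ is_prime P, P `<=` Q & ~ P x]) ->
  exists k, forall P, P \in s -> ~ P (b + x ^+ k.+1).
Proof.
move=> hQ Qx hs; apply: contrapT => nex.
(* Pigeonhole: if every exponent failed, [size s] + 1 of them would be assigned to [size s] primes,
   and two would share one. *)
have /choice[F hF] : forall k : 'I_(size s).+1, exists i : 'I_(size s),
    nth set0 s i (b + x ^+ k.+1).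
  move=> k; apply: contrapT => nk; apply: nex; exists k => P Ps PbX.
  apply: nk; have ls : (index P s < size s)%N by rewrite index_mem.
  by exists (Ordinal ls); rewrite /= nth_index.
have /injectivePn[k [l kl Fkl]] : ~~ injectiveb F.
  by apply/negP => /injectiveP/leq_card; rewrite !card_ord ltnn.
have {kl} : exists k l : 'I_(size s).+1, (k < l)%N /\ F k = F l.
  have [lt|lt|/val_inj e] := ltngtP k l; [by exists k, l|by exists l, k|].
  by rewrite e eqxx in kl.
move=> {k l Fkl} [k [l [kl Fkl]]].
have [hP PQ nPx] := hs _ (mem_nth set0 (ltn_ord (F k))).
have := idealB (prime_ideal hP) (hF k) _; rewrite Fkl => /(_ _ (hF l)).
have -> : b + x ^+ k.+1 - (b + x ^+ l.+1) = x ^+ k.+1 * (1 - x ^+ (l - k)).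
  by rewrite mulrBr mulr1 -exprD addSn subnKC 1?ltnW //; ring.
rewrite Fkl in hP PQ nPx.
apply: primeM => //; first exact: primeX.
move=> /PQ Q1; apply: (prime1 hQ); rewrite -(subrK (x ^+ (l - k)) 1).
apply: idealD (prime_ideal hQ) Q1 _.
by rewrite -(subnSK kl); exact: idealX (prime_ideal hQ) Qx.
Qed.

(** Induction on the list. If the [x] that avoids [s] lies in the new prime [P], take [y] in [Q]
    outside [P]: every [y + x ^+ k.+1] avoids [P], and some [k] makes it avoid [s] as well. *)
Lemma prime_avoidance (s : seq (set R)) Q : is_prime Q ->
  (forall P, P \in s -> [/\ is_prime P, P `<=` Q & ~ Q `<=` P]) ->
  exists2 x, Q x & forall P, P \in s -> ~ P x.
Proof.
move=> hQ; elim: s => [|P s IH] hs.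
  by exists 0 => //; exact: ideal0 (prime_ideal hQ).
have [P' P's|x Qx nx] := IH; first by apply: hs; rewrite inE P's orbT.
have [hP PQ /existsNP[y /not_implyP[Qy nPy]]] := hs P (mem_head _ _).
have [Px|nPx] := EM (P x); last first.
  by exists x => // P'; rewrite inE => /orP[/eqP->|/nx].
have [P' P's|k hk] := prime_avoidance_coset (s := s) y hQ Qx.
  have [] := hs P'; first by rewrite inE P's orbT.
  by split=> //; exact: nx.
exists (y + x ^+ k.+1) => [|P'].
  by apply: idealD (prime_ideal hQ) Qy _; exact: idealX (prime_ideal hQ) Qx.
rewrite inE => /orP[/eqP->|/hk//] Pyx; apply: nPy.
rewrite -(addrK (x ^+ k.+1) y); apply: idealB (prime_ideal hP) Pyx _.
exact: idealX (prime_ideal hP) Px.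
Qed.

End IdealTheory.

Arguments acc : clear implicits.

(** * Hilbert's basis theorem *)

Lemma acc_poly (A : comNzRingType) : acc A -> acc {poly A}.
Proof.
move=> accA I hI inc.
pose L k n : set A := [set c | exists2 p : {poly A}, I n p &
  (size p <= k.+1)%N /\ p`_k = c].
have hL k n : is_ideal (L k n).
  split.
  - by exists 0; [exact: ideal0|rewrite size_poly0 coef0].
  - move=> x y [p Ip [sp <-]] [p' Ip' [sp' <-]]; exists (p + p').
      exact: idealD.
    by rewrite coefD (leq_trans (size_polyD _ _)) // geq_max sp.
  - move=> a x [p Ip [sp <-]]; exists (a%:P * p); first exact: idealMl.
    by rewrite coefCM mul_polyC (leq_trans (size_scale_leq _ _)).
have incI m n (mn : (m <= n)%N) := chain_le inc mn.
have incn k m n : (m <= n)%N -> L k m `<=` L k n.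
  by move=> mn x [p Ip hp]; exists p => //; exact: incI _ _ mn _ Ip.
have inck k l n : (k <= l)%N -> L k n `<=` L l n.
  move=> kl x [p Ip [sp <-]]; exists (p * 'X^(l - k)); first exact: idealMr.
  rewrite coefMXn ltnNge leq_subr /= subKn //; split=> //.
  by rewrite (leq_trans (size_polyMleq _ _)) // size_polyXn; lia.
(* The diagonal handles all degrees from [N1] on; the finitely many lower degrees are stabilized
   separately by [N2]. *)
have [N1 hN1] := accA (fun n => L n n) (fun n => hL n n)
  (fun n => subset_trans (incn n n n.+1 (leqnSn n)) (inck n n.+1 n.+1 (leqnSn n))).
have [N2 hN2] : exists N, forall k, (k < N1)%N -> forall m, L k m `<=` L k N.
  elim: N1 {hN1} => [|K [N IH]]; first by exists 0%N.
  have [N' hN'] := accA (L K) (hL K) (fun n => incn K n n.+1 (leqnSn n)).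
  exists (maxn N N') => k; rewrite ltnS leq_eqVlt => /orP[/eqP->|kK] m.
    apply: subset_trans (incn _ _ _ (leq_maxr N' m)) _.
    apply: subset_trans (hN' _ (leq_maxl _ _)) _.
    exact: incn (leq_maxr _ _).
  exact: subset_trans (IH k kK m) (incn _ _ _ (leq_maxl _ _)).
set N := maxn N1 N2; exists N => m Nm p.
have [k] := ubnP (size p); elim: k p => // k IH p; rewrite ltnS => sp Ip.
have [->|p0] := eqVneq p 0; first exact: ideal0.
have sp0 : (0 < size p)%N by rewrite size_poly_gt0.
(* [q] has the same leading term as [p], so [p - q] has smaller size and still lies in [I m]. *)
have [q Iq [sq cq]] : L (size p).-1 N (lead_coef p).
  have : L (size p).-1 m (lead_coef p) by exists p => //; rewrite prednK.
  have [lt|ge] := ltnP (size p).-1 N1.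
    by move=> /(hN2 _ lt); exact: incn (leq_maxr _ _) _.
  (* Move up to a common diagonal term, back to [L N1 N1], then up to degree [(size p).-1] again. *)
  move=> /(incn _ _ _ (leq_maxr (size p).-1 m)).
  move=> /(inck _ _ _ (leq_maxl (size p).-1 m)).
  have leN : (N1 <= maxn (size p).-1 m)%N by rewrite leq_max ge.
  move=> /(hN1 _ leN) /(inck _ _ _ ge).
  exact: incn (leq_maxl _ _) _.
rewrite prednK // in sq.
rewrite -(subrK q p); apply: idealD => //; apply: IH.
  apply: leq_trans sp; rewrite -(prednK sp0) ltnS; apply/leq_sizeP => l.
  rewrite leq_eqVlt => /orP[/eqP<-|lt]; first by rewrite coefB cq subrr.
  rewrite prednK // in lt.
  by rewrite coefB !nth_default ?subrr // (leq_trans sq).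
by apply: idealB => //; exact: incI _ _ Nm _ Iq.
Qed.

(** * Contractions and integral extensions *)

Lemma preimage_ideal (A B : comNzRingType) (h : {rmorphism A -> B}) (I : set B) :
  is_ideal I -> is_ideal (h @^-1` I).
Proof.
move=> hI; split; rewrite /preimage /=.
- by rewrite rmorph0; exact: ideal0.
- by move=> x y; rewrite rmorphD; exact: idealD.
- by move=> a x; rewrite rmorphM; exact: idealMl.
Qed.

Lemma preimage_prime (A B : comNzRingType) (h : {rmorphism A -> B}) (P : set B) :
  is_prime P -> is_prime (h @^-1` P).
Proof.
move=> [hP n1 PM]; split; [exact: preimage_ideal|by rewrite /preimage /= rmorph1|].
by move=> x y; rewrite /preimage /= rmorphM; exact: PM.
Qed.

Lemma horner_map_cons (A B : comNzRingType) (h : {rmorphism A -> B})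
    (p : {poly A}) (c : A) (z : B) :
  (map_poly h (p * 'X + c%:P)).[z] = (map_poly h p).[z] * z + h c.
Proof. by rewrite rmorphD rmorphM /= map_polyX map_polyC hornerD hornerMX hornerC. Qed.

(* Incomparability: a monic relation of z modulo Q1 loses its constant term,
   which lies in Q \cap A = Q1 \cap A, and can then be divided by z. *)
Lemma incomparability (A B : comNzRingType) (h : {rmorphism A -> B})
    (Q1 Q : set B) (z : B) (f : {poly A}) : is_prime Q1 -> is_prime Q ->
  Q1 `<=` Q -> h @^-1` Q `<=` Q1 \o h -> f \is monic -> Q1 (map_poly h f).[z] ->
  Q z -> Q1 z.
Proof.
move=> hQ1 hQ Q1Q QA.
elim/poly_ind: f => [|f c IH]; first by rewrite monicE lead_coef0 eq_sym oner_eq0.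
have [->|f0] := eqVneq f 0.
  rewrite mul0r add0r monicE lead_coefC => /eqP->.
  by rewrite rmorph1 hornerC => /(prime1 hQ1).
rewrite horner_map_cons => fm Qf Qz.
have {}fm : f \is monic.
  move: fm; rewrite !monicE lead_coefDl ?lead_coefMX //.
  by rewrite size_polyC size_mulX // ltnS (leq_trans (leq_b1 _)) // size_poly_gt0.
have Q1c : Q1 (h c).
  apply: QA; rewrite /preimage /=.
  have -> : h c = (map_poly h f).[z] * z + h c - (map_poly h f).[z] * z by ring.
  apply: idealB (prime_ideal hQ) (Q1Q _ Qf) _.
  exact: idealMl (prime_ideal hQ) Qz.
have : Q1 ((map_poly h f).[z] * z).
  rewrite -(addrK (h c) (_ * z)); exact: idealB (prime_ideal hQ1) Qf Q1c.
by case: hQ1 => _ _ hM /hM[Q1f|//]; exact: IH.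
Qed.

(* Expanding u^n f(y) for f monic of degree n shows that (u y)^n is congruent
   to a multiple of u. *)
Lemma scaled_integral_equation (A B : comNzRingType) (h : {rmorphism A -> B})
    (M : set B) (f : {poly A}) (u a : A) (y : B) : is_ideal M ->
  M (h u * y - h a) ->
  exists c, M (h u ^+ (size f).-1 * (map_poly h f).[y] -
               h (lead_coef f * a ^+ (size f).-1 + u * c)).
Proof.
move=> hM Mua; elim/poly_ind: f => [|f c [d IH]].
  exists 0; rewrite map_poly0 horner0 lead_coef0 mul0r !mulr0 addr0 rmorph0 subrr.
  exact: ideal0.
have [->|f0] := eqVneq f 0.
  exists 0; rewrite mul0r add0r map_polyC hornerC lead_coefC size_polyC mulr0 addr0.
  by case: (c != 0); rewrite /= !expr0 mul1r mulr1 subrr; exact: ideal0.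
have sf : (0 < size f)%N by rewrite size_poly_gt0.
have sc : (size (c%:P : {poly A}) < size (f * 'X)%R)%N.
  by rewrite size_polyC size_mulX // ltnS (leq_trans (leq_b1 _)).
rewrite lead_coefDl // lead_coefMX size_polyDl // size_mulX //= horner_map_cons.
set n := (size f).-1 in IH *; rewrite -(prednK sf) -/n.
exists (d * a + u ^+ n * c).
set F := (map_poly h f).[y] in IH *; set l := lead_coef f in IH *.
have -> : h u ^+ n.+1 * (F * y + h c) -
    h (l * a ^+ n.+1 + u * (d * a + u ^+ n * c)) =
  (h u * y) * (h u ^+ n * F - h (l * a ^+ n + u * d)) +
  h (l * a ^+ n + u * d) * (h u * y - h a).
  by rewrite !(rmorphD, rmorphM, rmorphXn) !exprS; ring.
by apply: idealD => //; exact: idealMl.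
Qed.

(** An ideal [M] maximal among those contracting into [P] is prime, and integrality forces its
    contraction to be all of [P]. *)
Lemma lying_over (A B : comNzRingType) (h : {rmorphism A -> B}) (P : set A) :
  injective h -> integral_extension h -> is_prime P ->
  exists2 Q : set B, is_prime Q & h @^-1` Q = P.
Proof.
move=> injh inth hP.
(* [F] does not ask for 0, so that the empty union qualifies. A maximal [M] without 0 would be
   empty, hence strictly below the zero ideal. *)
pose F (Q : set B) := [/\ forall x y, Q x -> Q y -> Q (x + y),
  forall a x, Q x -> Q (a * x) & h @^-1` Q `<=` P].
have [G FG totG|M [[MD MM MP] maxM]] := @Zorn_bigcup B F.
  split=> [x y [X GX Xx] [Y GY Yy]|a x [X GX Xx]|a [X GX Xa]].
  - have [XY|YX] := totG _ _ GX GY.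
      by exists Y => //; have [D _ _] := FG _ GY; apply: D => //; exact: XY.
    by exists X => //; have [D _ _] := FG _ GX; apply: D => //; exact: YX.
  - by exists X => //; have [_ XM _] := FG _ GX; exact: XM.
  - by have [_ _] := FG _ GX; apply.
have M0 : M 0.
  apply: contrapT => nM0; apply: (maxM [set 0]); last first.
    split=> [x y -> ->|a x ->|a]; rewrite ?addr0 ?mulr0 //.
    rewrite /preimage /= -(rmorph0 h) => /injh ->.
    exact: ideal0 (prime_ideal hP).
  split=> [x /(MM 0)|sub]; first by rewrite mul0r.
  by apply: nM0; exact: sub.
have hM : is_ideal M by split.
have meets x : ~ M x -> exists2 a, ~ P a & ideal_adjoin M x (h a).
  move=> nMx; apply: contrapT => nex; apply: (maxM (ideal_adjoin M x)).
    split; first exact: sub_ideal_adjoin.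
    by move=> sub; apply: nMx; apply: sub; exact: mem_ideal_adjoin.
  have [_ D Mu] := ideal_adjoin_ideal x hM; split=> // a Ma.
  by apply: contrapT => nPa; apply: nex; exists a.
have pM : is_prime M.
  split=> // [M1|x y Mxy]; first by apply: (prime1 hP); apply: MP; rewrite /= rmorph1.
  apply: contrapT => /not_orP[/meets[a nPa [r Ha]] /meets[b nPb [r' Hb]]].
  apply: (primeM hP nPa nPb); apply: MP; rewrite /= rmorphM.
  have -> : h a * h b = h b * (h a - r * x) + (r * x) * (h b - r' * y) + (r * r') * (x * y).
    by ring.
  by apply: idealD (idealMl _ hM Mxy) => //; apply: idealD => //; exact: idealMl.
(* If [h u] were outside [M], then [h a] would be [y * h u] modulo [M] for some [a] outside [P]. An
   integral equation of [y] puts [a ^+ n + u * c] in [P] for some [n] and [c], hence a power of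
   [a]. *)
exists M => //; apply/seteqP; split=> // u Pu; apply: contrapT => /meets[a nPa [y Ha]].
have [f fm /rootP fy] := inth y.
have [|c] := scaled_integral_equation (h := h) f hM (u := u) (a := a) (y := y).
  by rewrite -opprB mulrC; exact: idealN.
rewrite fy mulr0 sub0r (monicP fm) mul1r => /(idealN hM); rewrite opprK => /MP Pauc.
apply: (primeX (n := (size f).-1) hP nPa); rewrite -(addrK (u * c) (_ ^+ _)).
by apply: idealB (prime_ideal hP) Pauc _; exact: idealMr (prime_ideal hP) Pu.
Qed.

(** * Comparing two primes over [P] *)

(** Exchanging [Q] and [Q'] gives equality. The prime [P1] witnesses that [P] is not minimal
    regular; going down lifts it to a prime [Q1] inside [Q]. *)
Lemma primes_over_sub (A B : comNzRingType) (K : comUnitRingType)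
    (phi : {rmorphism A -> K}) (i : {rmorphism A -> B}) (j : {rmorphism B -> K})
    (P P1 : set A) (Q Q' : set B) :
  acc A -> is_GD_overring phi i j -> integral_extension i ->
  is_prime P -> is_regular_prime P1 -> P1 `<=` P -> ~ P `<=` P1 ->
  is_prime Q -> is_prime Q' -> i @^-1` Q = P -> i @^-1` Q' = P -> Q `<=` Q'.
Proof.
move=> accA [[[phi_inj phi_unit phi_frac] j_inj ij] gd] inti hP.
move=> [hP1 [s1 P1s1 reg_s1]] P1P nPP1 hQ hQ' QP Q'P b Qb.
apply: contrapT => nQ'b.
(* Regular elements of [A] become units in [K], so they stay regular in [B]. *)
have i_reg s z : GRing.lreg s -> i s * z = 0 -> z = 0.
  move=> reg_s sz0; apply: j_inj; apply: (mulrI (phi_unit s reg_s)).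
  by rewrite -[phi s]ij /= -rmorphM sz0 !rmorph0 mulr0.
have [a [s [reg_s jb]]] := phi_frac (j b).
have sb : i s * b = i a.
  apply: j_inj; rewrite rmorphM jb /= -[j (i s)]/((j \o i) s) -[j (i a)]/((j \o i) a).
  by rewrite !ij mulrC divrK //; exact: phi_unit.
pose g : {rmorphism {poly A} -> B} := horner_eval b \o map_poly i.
have gE p : g p = (map_poly i p).[b] by [].
have gC c : g c%:P = i c by rewrite gE map_polyC hornerC.
have gX : g 'X = b by rewrite gE map_polyX hornerX.
clearbody g.
pose I := g @^-1` [set 0].
have hI : is_ideal I.
  by apply: preimage_ideal; split=> [|x y -> ->|c x ->]; rewrite ?addr0 ?mulr0.
have I_reg c : GRing.lreg c -> forall z, I (c%:P * z) -> I z.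
  by move=> reg_c z; rewrite /I /preimage /= rmorphM gC; exact: i_reg.
have accR := acc_poly accA.
have sub_pre q : is_prime q -> I `<=` g @^-1` q.
  by move=> hq z; rewrite /I /preimage /= => ->; exact: ideal0 (prime_ideal hq).
have [Q1 [hQ1 Q1Q Q1P]] := gd P1 P Q hP1 hP hQ P1P QP.
pose QR := g @^-1` Q; pose Q1R := g @^-1` Q1.
have hQR : is_prime QR by exact: preimage_prime.
have QRC c : QR c%:P <-> P c by rewrite /QR /preimage /= gC -QP.
(* [L0] includes all primes minimal over [I] + ([s]), and [L] keeps the members strictly below
   [QR]. *)
have [L0 [L0p L0below]] := finite_primes_below accR (ideal_adjoin_ideal s%:P hI).
pose L := [seq q <- L0 | `[< q `<=` QR /\ ~ QR `<=` q >]].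
have Lp q : q \in L -> [/\ is_prime q, I `<=` q, q `<=` QR & ~ QR `<=` q].
  rewrite mem_filter => /andP[/asboolP[qQ nQq] /L0p[hq Iq]]; split=> //.
  exact: subset_trans (sub_ideal_adjoin _ hI) Iq.
have [x Px Lx] : exists2 x, P x & forall q, q \in L -> ~ q x%:P.
  (* Avoidance takes place in [A], for the contractions of the primes in [L]. None contains [P], by
     incomparability: modulo [I], [{poly A}] embeds in [B] and is integral over [A]. *)
  pose C (q : set {poly A}) : set A := polyC @^-1` q.
  have [|x Px nx] := prime_avoidance (s := map C L) hP.
    move=> _ /mapP[q /Lp[hq Iq qQ nQq] ->]; split.
    - exact: preimage_prime.
    - by move=> c /qQ/QRC.
    - move=> Pq; apply: nQq => z Qz.
      have [f fm /rootP fz] := inti (g z).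
      apply: (incomparability (h := polyC) (f := f) hq hQR qQ _ fm _ Qz).
        by move=> c /QRC/Pq.
      apply: Iq; rewrite /I /preimage /= -horner_map /= -map_poly_comp.
      rewrite -fz; congr (_.[_]); apply: eq_map_poly => c; exact: gC.
  by exists x => // q qL; exact: (nx (C q) (map_f C qL)).
have [|k hk] := prime_avoidance_coset (s := L) 'X hQR ((QRC x).2 Px).
  by move=> q qL; have [hq _ qQ _] := Lp q qL; split=> //; exact: Lx.
set beta := 'X + _ in hk.
have gbeta : g beta = b + i (x ^+ k.+1) by rewrite rmorphD gX -polyC_exp gC.
have PxX : P (x ^+ k.+1) by exact: idealX (prime_ideal hP) Px.
have QRbeta : QR beta.
  rewrite /QR /preimage /= gbeta; apply: idealD (prime_ideal hQ) Qb _.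
  by move: PxX; rewrite -QP.
have IQR : I `<=` QR by exact: sub_pre.
have [q [hq Iq qQ minq]] := minimal_prime_exists accR
  (ideal_adjoin_ideal beta hI) hQR
  (ideal_adjoin_sub (prime_ideal hQR) IQR QRbeta).
have qbeta : q beta by apply: Iq; exact: mem_ideal_adjoin.
have {}Iq : I `<=` q by exact: subset_trans (sub_ideal_adjoin _ hI) Iq.
have {}minq q' : is_prime q' -> I `<=` q' -> q' beta -> q' `<=` q -> q `<=` q'.
  move=> hq' Iq' q'b; apply: minq => //.
  exact: ideal_adjoin_sub (prime_ideal hq') Iq' q'b.
(* With [minq], a prime between [I] and [q] that contains a regular constant must be [q] itself. *)
have krull q' c : is_prime q' -> I `<=` q' -> q' `<=` q -> GRing.lreg c ->
    q' c%:P -> q' beta.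
  move=> hq' Iq' q'q reg_c q'c.
  exact: (krull_principal_ideal accR hI hq' hq Iq' q'q qbeta
    minq q'c (I_reg c reg_c)).
have [qs|nqs] := EM (q s%:P).
  have [q0 q0L q0q] := L0below q hq (ideal_adjoin_sub (prime_ideal hq) Iq qs).
  have [hq0 Iq0] := L0p q0 q0L.
  have q0s : q0 s%:P by apply: Iq0; exact: mem_ideal_adjoin.
  have {}Iq0 : I `<=` q0 by exact: subset_trans (sub_ideal_adjoin _ hI) Iq0.
  have q0beta := krull q0 s hq0 Iq0 q0q reg_s q0s.
  (* Strictly below [QR], [q0] would be in [L], whose members avoid [beta]. So [q0] and [q] equal
     [QR]; then [Q1R], which contains the regular constant [s1], would contain [q]. *)
  have [Qq0|nQq0] := EM (QR `<=` q0); last first.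
    apply: (hk q0) => //; rewrite mem_filter q0L andbT; apply/asboolP; split=> //.
    exact: subset_trans q0q qQ.
  have Q1q : Q1R `<=` q.
    by move=> z Q1z; apply/q0q/Qq0; exact: Q1Q.
  have hQ1R : is_prime Q1R by exact: preimage_prime.
  have Q1s1 : Q1R s1%:P by move: P1s1; rewrite -Q1P /Q1R /preimage /= gC.
  have IQ1 : I `<=` Q1R by exact: sub_pre.
  have qQ1 := minq Q1R hQ1R IQ1 (krull Q1R s1 hQ1R IQ1 Q1q reg_s1 Q1s1) Q1q.
  apply: nPP1 => c /QRC/Qq0/q0q/qQ1.
  by rewrite -Q1P /Q1R /preimage /= gC.
have hp : is_prime (polyC @^-1` q) by exact: preimage_prime.
have pP : polyC @^-1` q `<=` P by move=> c /qQ/QRC.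
have [q' [hq' q'Q' q'p]] := gd _ _ _ hp hP hQ' pP Q'P.
have sbeta : i (a + s * x ^+ k.+1) = i s * g beta.
  by rewrite gbeta mulrDr sb rmorphD rmorphM.
have : q' (i s * g beta).
  rewrite -sbeta -[q' _]/((i @^-1` q') _) q'p /preimage /=.
  (* The constant [a + s * x ^+ k.+1] agrees with [s%:P * beta] modulo [I], so it lies in [q]. *)
  rewrite -(subrK (s%:P * beta) (_ %:P)); apply: idealD (prime_ideal hq) _ _.
    by apply: Iq; rewrite /I /preimage /= rmorphB rmorphM !gC sbeta subrr.
  exact: idealMl (prime_ideal hq) qbeta.
case: hq' => _ _ hM /hM[q's|/q'Q'].
  by apply: nqs; move: q's; rewrite -[q' _]/((i @^-1` q') _) q'p.
rewrite gbeta => Q'bx; apply: nQ'b; rewrite -(addrK (i (x ^+ k.+1)) b).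
by apply: idealB (prime_ideal hQ') Q'bx _; move: PxX; rewrite -Q'P.
Qed.

Theorem theorem26 (A B : comNzRingType) (K : comUnitRingType)
    (phi : {rmorphism A -> K}) (i : {rmorphism A -> B})
    (j : {rmorphism B -> K})
    (hA : noetherian A)
    (hB : is_GD_overring phi i j)
    (hint : integral_extension i) :
  forall P : set A, is_regular_prime P -> ~ is_minimal_regular_prime P ->
    unibranched i P.
Proof.
move=> P regP nminP; have hP := regP.1.
have [P1 [regP1 P1P nPP1]] : exists P1,
    [/\ is_regular_prime P1, P1 `<=` P & ~ P `<=` P1].
  apply: contrapT => nex; apply: nminP; split=> // P1 regP1 P1P.
  apply/seteqP; split=> //; apply: contrapT => nPP1.
  by apply: nex; exists P1.
have i_inj : injective i.
  have [[[phi_inj _ _] _ ij] _] := hB.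
  by move=> x y ixy; apply: phi_inj; rewrite -!ij /= ixy.
(* Lying over gives existence; the inclusion in both directions gives uniqueness. *)
have [Q hQ QP] := lying_over i_inj hint hP.
have over := primes_over_sub (noetherian_acc hA) hB hint
  hP regP1 P1P nPP1.
by exists Q; split=> // Q' [hQ' Q'P]; apply/seteqP; split; exact: over.
Qed.
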